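(* Let $G$ be a compact, connected, semisimple Lie group with center $Z(G)$. Let $\Sigma$ be a compact, closed nonorientable surface and $\tilde{\Sigma}$ its orientable double cover. Then the natural map from the moduli space $\mathcal{M}$ of flat $G$-connections on $\Sigma$ into the fixed point set of the involution on the moduli space $\tilde{\mathcal{M}}$ of flat $G$-connections on $\tilde{\Sigma}$ is a $|Z(G)/2Z(G)|$ to one map. In particular, (the smooth part of) the moduli space $\mathcal{M}$ is isomorphic to (the smooth part of) the fixed point set of the involution on the moduli space $\tilde{\mathcal{M}}$ if and only if $|Z(G)|$ is odd.
   Context: $2Z(G)=\{g^2\mid g\in Z(G)\}$ is a subgroup of the finite abelian group $Z(G)$. The moduli spaces $\mathcal{M}$ and $\tilde{\mathcal{M}}$ are the spaces of gauge equivalence classes of flat $G$-connections on $\Sigma$ and $\tilde\Sigma$ respectively. The involution $\tau$ on $\tilde{\mathcal{M}}$ is the one induced by the $\mathbb{Z}_2$-action on $\tilde\Sigma$ whose quotient is $\Sigma$. Explicit models, with $\Sigma_\ell$ a Riemann surface of genus $\ell$ and $[a,b]=aba^{-1}b^{-1}$: Case 1: $\Sigma=\Sigma_\ell\sharp\mathbb{RP}^2$ (so $\tilde\Sigma$ has genus $2\ell$). Write $V=(a_1,b_1,\dots,a_\ell,b_\ell)$, $\bar V=(\bar a_1,\bar b_1,\dots,\bar a_\ell,\bar b_\ell)$, and $$M=\Big\{(V,c,\bar V,\bar c)\in G^{2(2\ell+1)}\;\Big|\;\prod_{i=1}^\ell[a_i,b_i]=c\bar c,\ \prod_{i=1}^\ell[\bar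 a_i,\bar b_i]=\bar c c\Big\}.$$ Case 2: $\Sigma=\Sigma_\ell\sharp(\text{Klein bottle})$ (so $\tilde\Sigma$ has genus $2\ell+1$). Write $V=(a_1,b_1,\dots,a_\ell,b_\ell,d)$, $\bar V=(\bar a_1,\bar b_1,\dots,\bar a_\ell,\bar b_\ell,\bar d)$, and $$M=\Big\{(V,c,\bar V,\bar c)\in G^{2(2\ell+2)}\;\Big|\;\prod_{i=1}^\ell[a_i,b_i]=c\bar d c^{-1}d,\ \prod_{i=1}^\ell[\bar a_i,\bar b_i]=\bar c d\bar c^{-1}\bar d\Big\}.$$ In both cases $K=G\times G$ acts on $M$ by $$(g_1,g_2)\cdot(V,c,\bar V,\bar c)=(g_1Vg_1^{-1},\,g_1cg_2^{-1},\,g_2\bar Vg_2^{-1},\,g_2\bar cg_1^{-1}),$$ where $gVg^{-1}$ means conjugating each entry of $V$ by $g$. There are involutions $\tau(g_1,g_2)=(g_2,g_1)$ on $K$ and $\tau(V,c,\bar V,\bar c)=(\bar V,\bar c,V,c)$ on $M$, with $\tau(k\cdot x)=\tau(k)\cdot\tau(x)$, so $\tau$ induces an involution $\tau([x])=[\tau(x)]$ on $M/K$. A superscript $\tau$ denotes a fixed point set. The moduli space $\tilde{\mathcal{M}}$ is identified with $M/K$ (by holonomy with two base points), and $\mathcal{M}$ is identified with $M^\tau/K^\tau$. The natural map is $$I:M^\tau/K^\tau\to(M/K)^\tau,\qquad [[(V,c,V,c)]]\mapsto[(V,c,V,c)],$$ where $[[\cdot]]$ denotes the class in $M^\tau/K^\tau$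 and $[\cdot]$ the class in $(M/K)^\tau$. Smooth part: points whose stabilizer is equal to the center (called generic points) correspond to the smooth part of the moduli space of flat connections, which is an open dense subset.
   Formalization: The |Z(G)/2Z(G)|-to-one claim is stated only at smooth points (stabilizer in G×G equal to the center), as it fails elsewhere, e.g. for SO(3); ''isomorphic'' means the natural map is a homeomorphism of smooth parts, and the iff assumes the fixed set's smooth part is nonempty. *)

(* Defs.v *)
From HB Require Import structures.
From mathcomp Require Import all_boot all_order all_algebra.
From mathcomp Require Import all_classical all_reals all_analysis.
Import numFieldNormedType.Exports.

Set Implicit Arguments.
Unset Strict Implicit.
Unset Printing Implicit Defensive.

Local Open Scope classical_set_scope.
Local Open Scope ring_scope.

Definition homeo_with (X Y : topologicalType) (A : set X) (B : set Y)
    (f : X -> Y) (g : Y -> X) : Prop :=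
  [/\ set_fun A B f, set_fun B A g,
      (forall x, A x -> g (f x) = x), (forall y, B y -> f (g y) = y)
    & {within A, continuous f} /\ {within B, continuous g}].

Definition restricts_to_homeo (X Y : topologicalType) (A : set X) (B : set Y)
    (f : X -> Y) : Prop :=
  exists g : Y -> X, homeo_with A B f g.

(* [Ck k U f]: f is of class C^k on U; only meaningful for U open. *)
Fixpoint Ck (R : realType) (m p k : nat) (U : set 'rV[R]_m)
    (f : 'rV[R]_m -> 'rV[R]_p) : Prop :=
  match k with
  | 0 => forall x, U x -> {for x, continuous f}
  | k'.+1 => (forall x, U x -> differentiable f x) /\
             (forall v, Ck k' U (fun x => 'D_v f x))
  end.

Definition smooth_on (R : realType) (m p : nat) (U : set 'rV[R]_m)
    (f : 'rV[R]_m -> 'rV[R]_p) : Prop :=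
  forall k, Ck k U f.

Record chart (R : realType) (n : nat) (X : topologicalType) := Chart {
  chart_dom : set X;
  chart_cod : set 'rV[R]_n;
  chart_map :> X -> 'rV[R]_n;
  chart_inv : 'rV[R]_n -> X;
  chart_dom_open : open chart_dom;
  chart_cod_open : open chart_cod;
  chart_homeo : homeo_with chart_dom chart_cod chart_map chart_inv
}.

(* Real Lie groups of dimension n: a group on a Hausdorff second countable
   space with a smooth atlas for which the operations are continuous, and
   smooth in every triple (resp. pair) of charts of the atlas.  'rV_(n + n)
   plays the role of R^n x R^n. *)
HB.mixin Record isLieGroup (R : realType) (n : nat) G
    of Group G & Topological G := {
  atlas : set (chart R n G);
  lie_hausdorff : hausdorff_space G;
  lie_second_countable : @second_countable G;
  atlas_cover : forall g : G, exists2 c, atlas c & chart_dom c g;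
  atlas_smooth : forall c1 c2, atlas c1 -> atlas c2 ->
    smooth_on (chart_cod c1 `&` chart_inv c1 @^-1` chart_dom c2)
      (fun u => c2 (chart_inv c1 u));
  lie_mul_continuous : continuous (fun p : G * G => (p.1 * p.2)%g);
  lie_inv_continuous : continuous (fun g : G => g^-1%g);
  lie_mul_smooth : forall c1 c2 c3, atlas c1 -> atlas c2 -> atlas c3 ->
    smooth_on
      [set w : 'rV[R]_(n + n) |
        [/\ chart_cod c1 (lsubmx w), chart_cod c2 (rsubmx w)
          & chart_dom c3 (chart_inv c1 (lsubmx w) * chart_inv c2 (rsubmx w))%g]]
      (fun w => c3 (chart_inv c1 (lsubmx w) * chart_inv c2 (rsubmx w))%g);
  lie_inv_smooth : forall c1 c2, atlas c1 -> atlas c2 ->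
    smooth_on
      [set u | chart_cod c1 u /\ chart_dom c2 (chart_inv c1 u)^-1%g]
      (fun u => c2 (chart_inv c1 u)^-1%g)
}.

#[short(type="lieGroupType")]
HB.structure Definition LieGroup (R : realType) (n : nat) :=
  {G of isLieGroup R n G & Group G & Topological G}.

Section LieAlgebra.
Context (R : realType) (n : nat).

Definition lie_ideal (br : 'rV[R]_n -> 'rV[R]_n -> 'rV[R]_n)
    (I : {vspace 'rV[R]_n}) : Prop :=
  forall x y, y \in I -> br x y \in I.

Definition derived_space (br : 'rV[R]_n -> 'rV[R]_n -> 'rV[R]_n)
    (U : {vspace 'rV[R]_n}) : {vspace 'rV[R]_n} :=
  <<[seq br x y | x <- vbasis U, y <- vbasis U]>>%VS.

Definition solvable_space (br : 'rV[R]_n -> 'rV[R]_n -> 'rV[R]_n)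
    (U : {vspace 'rV[R]_n}) : Prop :=
  exists k, iter k (derived_space br) U = 0%VS.

Definition semisimple_bracket (br : 'rV[R]_n -> 'rV[R]_n -> 'rV[R]_n) : Prop :=
  forall I, lie_ideal br I -> solvable_space br I -> I = 0%VS.

(* The Lie bracket on T_1 G, read in a chart c at 1: if mu (x, y) is the group
   law in the chart and e = c 1, then [u, v] = B (u, v) - B (v, u), where
   B (u, v) is the mixed second derivative of mu at (e, e) in the direction u
   of the first variable and v of the second.  Changing the chart transports
   this bracket by the differential of the transition map. *)
Definition lie_bracket (G : lieGroupType R n) (c : chart R n G)
    (u v : 'rV[R]_n) : 'rV[R]_n :=
  let mu x y := c (chart_inv c x * chart_inv c y)%g in
  let e := c 1%g in
  'D_u (fun x => 'D_v (mu x) e) e - 'D_v (fun x => 'D_u (mu x) e) e.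

Definition semisimple (G : lieGroupType R n) : Prop :=
  forall c : chart R n G, atlas c -> chart_dom c 1%g ->
    semisimple_bracket (lie_bracket c).

End LieAlgebra.

Section Center.
Context (G : groupType).
Local Open Scope group_scope.

Definition group_center : set G := [set z | forall g, z * g = g * z].

(* The subgroup written 2Z(G) for the additive structure of Z(G). *)
Definition center_squares : set G := [set z * z | z in group_center].

(* The set of cosets of 2Z(G) in Z(G). *)
Definition center_mod_squares : set (set G) :=
  [set [set z * w | w in center_squares] | z in group_center].

Definition odd_card (T : Type) (A : set T) : Prop :=
  exists2 m : nat, odd m & (A #= `I_m)%card.

End Center.
Arguments group_center G : clear implicits.
Arguments center_mod_squares G : clear implicits.

(* [CrossCap l] is Sigma_l # RP^2 and [Klein l] is Sigma_l # (Klein bottle);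
   every closed nonorientable surface is one of these. *)
Variant nonorientable_surface := CrossCap of nat | Klein of nat.

Definition width (S : nonorientable_surface) : nat :=
  match S with
  | CrossCap l => l + l
  | Klein l => l + l + 1
  end%N.

(* A configuration ((V, c), (V', c')) stands for (V, c, \bar V, \bar c).  The
   row V lists a_1 .. a_l b_1 .. b_l, followed by d for [Klein l]. *)
Definition config (G : Type) (N : nat) : Type :=
  (('rV[G]_N * G) * ('rV[G]_N * G))%type.

Section Models.
Context {G : groupType}.
Local Open Scope group_scope.

(* The library's [~ a, b] is a^-1 b^-1 a b. *)
Definition comm (a b : G) : G := a * b * a^-1 * b^-1.

Definition surface_word (l : nat) (V : 'rV[G]_(l + l)) : G :=
  \prod_(i < l) comm (lsubmx V ord0 i) (rsubmx V ord0 i).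

Definition rep_set (S : nonorientable_surface) : set (config G (width S)) :=
  match S return set (config G (width S)) with
  | CrossCap l => [set x |
      let: ((V, c), (V', c')) := x in
      surface_word V = c * c' /\ surface_word V' = c' * c]
  | Klein l => [set x |
      let: ((W, c), (W', c')) := x in
      let V := lsubmx W in let d := rsubmx W ord0 ord0 in
      let V' := lsubmx W' in let d' := rsubmx W' ord0 ord0 in
      surface_word V = c * d' * c^-1 * d /\
      surface_word V' = c' * d * c'^-1 * d']
  end.

Arguments rep_set S : clear implicits.

Definition conj_row (N : nat) (g : G) (V : 'rV[G]_N) : 'rV[G]_N :=
  map_mx (fun h => g * h * g^-1) V.

Definition act (N : nat) (k : G * G) (x : config G N) : config G N :=
  let: ((V, c), (V', c')) := x in
  ((conj_row k.1 V, k.1 * c * k.2^-1), (conj_row k.2 V', k.2 * c' * k.1^-1)).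

Definition tau_group (k : G * G) : G * G := (k.2, k.1).

Definition tau_config (N : nat) (x : config G N) : config G N := (x.2, x.1).

Definition rep_fix_set (S : nonorientable_surface) : set (config G (width S)) :=
  rep_set S `&` [set x | tau_config x = x].

Definition K_tau : set (G * G) := [set k | tau_group k = k].

(* The center of G acts trivially through z |-> (z, z); x is generic when its
   stabilizer in K = G x G is no larger.  These points give the smooth part. *)
Definition generic (N : nat) (x : config G N) : Prop :=
  [set k | act k x = x] = [set (z, z) | z in group_center G].

Arguments rep_fix_set S : clear implicits.

Lemma act1 N (x : config G N) : act 1 x = x.
Proof.
case: x => [[V c] [V' c']]; rewrite /act /= invg1 !mulg1 !mul1g.
by congr ((_, _), (_, _)); apply/matrixP => i j; rewrite mxE invg1 mulg1 mul1g.
Qed.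

Lemma actM N (k h : G * G) (x : config G N) : act k (act h x) = act (k * h) x.
Proof.
case: x => [[V c] [V' c']]; rewrite /act /=.
by congr ((_, _), (_, _)); rewrite ?invgM ?mulgA //;
  apply/matrixP => i j; rewrite !mxE invgM !mulgA.
Qed.

Lemma tau_act N (k : G * G) (x : config G N) :
  tau_config (act k x) = act (tau_group k) (tau_config x).
Proof. by case: x => [[V c] [V' c']]. Qed.

Lemma tau_rep_set S (x : config G (width S)) :
  rep_set S x -> rep_set S (tau_config x).
Proof. by case: S x => l [[V c] [V' c']] /= []. Qed.

End Models.

Section Moduli.
Context (R : realType) (n : nat) (G : lieGroupType R n).
Context (S : nonorientable_surface).
Local Open Scope quotient_scope.

(* M and M^tau with the subspace topologies. *)
Definition rep : topologicalType := @rep_set G S : Type.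
Definition rep_fix : topologicalType := @rep_fix_set G S : Type.

Definition rep_rel (x y : rep) : bool :=
  `[< exists k : G * G, act k (val x) = val y >].

Definition rep_fix_rel (x y : rep_fix) : bool :=
  `[< exists2 k : G * G, K_tau k & act k (val x) = val y >].

Lemma rep_rel_refl : reflexive rep_rel.
Proof. by move=> x; apply/asboolP; exists 1%g; exact: act1. Qed.

Lemma rep_rel_sym : symmetric rep_rel.
Proof.
move=> x y; apply/asboolP/asboolP => -[k kxy]; exists k^-1%g;
  by rewrite -kxy actM mulVg act1.
Qed.

Lemma rep_rel_trans : transitive rep_rel.
Proof.
move=> y x z /asboolP[k kxy] /asboolP[h hyz]; apply/asboolP.
by exists (h * k)%g; rewrite -actM kxy.
Qed.

Lemma rep_fix_rel_refl : reflexive rep_fix_rel.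
Proof. by move=> x; apply/asboolP; exists 1%g => //; exact: act1. Qed.

Lemma rep_fix_rel_sym : symmetric rep_fix_rel.
Proof.
move=> x y; apply/asboolP/asboolP => -[[k1 k2] [Kk1 Kk2] kxy];
  by exists (k1, k2)^-1%g; rewrite -?kxy ?actM ?mulVg ?act1 //;
  rewrite /K_tau /tau_group /= Kk1.
Qed.

Lemma rep_fix_rel_trans : transitive rep_fix_rel.
Proof.
move=> y x z /asboolP[[k1 k2] [k21 _] kxy] /asboolP[[h1 h2] [h21 _] hyz].
apply/asboolP; exists ((h1, h2) * (k1, k2))%g; last by rewrite -actM kxy.
by rewrite /K_tau /tau_group /= k21 h21.
Qed.

Canonical rep_equiv :=
  EquivRel rep_rel rep_rel_refl rep_rel_sym rep_rel_trans.
Canonical rep_fix_equiv :=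
  EquivRel rep_fix_rel rep_fix_rel_refl rep_fix_rel_sym rep_fix_rel_trans.

(* M / K and M^tau / K^tau, with the quotient topologies: the moduli spaces of
   flat connections on the orientable double cover and on S respectively. *)
Definition moduli_cover : topologicalType :=
  quotient_topology {eq_quot rep_equiv}.
Definition moduli : topologicalType :=
  quotient_topology {eq_quot rep_fix_equiv}.

Definition cover_class (x : rep) : moduli_cover := \pi_({eq_quot rep_equiv}) x.
Definition class (x : rep_fix) : moduli := \pi_({eq_quot rep_fix_equiv}) x.

Definition cover_repr (q : moduli_cover) : rep :=
  repr (q : {eq_quot rep_equiv}).
Definition class_repr (p : moduli) : rep_fix :=
  repr (p : {eq_quot rep_fix_equiv}).

Definition tau_rep (x : rep) : rep :=
  exist _ (tau_config (val x)) (mem_set (tau_rep_set (set_mem (valP x)))).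

Definition rep_incl (x : rep_fix) : rep :=
  exist _ (val x) (mem_set (set_mem (valP x)).1).

(* The induced involution [x] |-> [tau x] and the natural map [[x]] |-> [x];
   see [tau_moduliE] and [natural_mapE]. *)
Definition tau_moduli (q : moduli_cover) : moduli_cover :=
  cover_class (tau_rep (cover_repr q)).

Definition natural_map (p : moduli) : moduli_cover :=
  cover_class (rep_incl (class_repr p)).

Definition fixed_locus : set moduli_cover := [set q | tau_moduli q = q].

(* Genericity of a point of M^tau is that of the point of M it is, i.e. it
   bears on the stabilizer in K and not only in K^tau. *)
Definition smooth_moduli : set moduli :=
  [set class x | x in [set x : rep_fix | generic (val x)]].

Definition smooth_fixed_locus : set moduli_cover :=
  fixed_locus `&` [set cover_class x | x in [set x : rep | generic (val x)]].

Lemma cover_classP (x y : rep) :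
  cover_class x = cover_class y <-> exists k : G * G, act k (val x) = val y.
Proof.
split=> [xy|/asboolP xy]; last exact/(@eqmodP _ rep_equiv).
by apply/asboolP; apply/(@eqmodP _ rep_equiv).
Qed.

Lemma classP (x y : rep_fix) :
  class x = class y <->
  exists2 k : G * G, K_tau k & act k (val x) = val y.
Proof.
split=> [xy|/asboolP xy]; last exact/(@eqmodP _ rep_fix_equiv).
by apply/asboolP; apply/(@eqmodP _ rep_fix_equiv).
Qed.

Lemma cover_reprK (q : moduli_cover) : cover_class (cover_repr q) = q.
Proof. exact: (reprK (q : {eq_quot rep_equiv})). Qed.

Lemma class_reprK (p : moduli) : class (class_repr p) = p.
Proof. exact: (reprK (p : {eq_quot rep_fix_equiv})). Qed.

Lemma tau_moduliE (x : rep) :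
  tau_moduli (cover_class x) = cover_class (tau_rep x).
Proof.
have /cover_classP[k kx] := cover_reprK (cover_class x).
by apply/cover_classP; exists (tau_group k);
  exact: etrans (esym (tau_act _ _)) (congr1 (@tau_config _ _) kx).
Qed.

Lemma natural_mapE (x : rep_fix) :
  natural_map (class x) = cover_class (rep_incl x).
Proof.
have /classP[k _ kx] := class_reprK (class x).
by apply/cover_classP; exists k.
Qed.

End Moduli.
Arguments natural_map {R n} G S.
Arguments smooth_moduli {R n} G S.
Arguments fixed_locus {R n} G S.
Arguments smooth_fixed_locus {R n} G S.

(* Main.v *)
Require Import Defs.
From mathcomp Require Import all_boot all_order all_algebra.
From mathcomp Require Import all_classical all_reals all_analysis.
From mathcomp Require Import ring lra finmap.
Import Order.TTheory GRing.Theory Num.Theory.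
Import numFieldNormedType.Exports.

(** Let x be a generic point of M^tau and suppose that the class of a tau-fixed
point y equals that of x in M / K, say y = (g, h) x.  Applying tau gives
y = (h, g) x as well, so (g, h)^-1 (h, g) stabilizes x and is (z, z) with z
central; comparing components, z^2 = 1 and y = (g, g) (1, z) x.  Conversely
(1, z) x is tau-fixed for every central z with z^2 = 1, and these points have
distinct classes in M^tau / K^tau.  So the fibre of the natural map through x
is in bijection with the 2-torsion of Z(G) ([fibre_card]).  When Z(G) is
finite, the 2-torsion has as many elements as the quotient of Z(G) by its
squares, the kernel and the cokernel of squaring
([card_center_involutions]).

Finiteness of Z(G) is where compactness and semisimplicity enter
([center_finite]).  If central elements accumulated at 1, a limit u of their
normalized coordinates in a chart would satisfy [u, v] = 0 for all v, because
z y = y z differentiates to the vanishing of the bracket; this uses the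
symmetry of second derivatives ([mixed_derive_sym]).  The line spanned by u
would be a nonzero abelian ideal of the Lie algebra ([center_isolated]).  A
subgroup of a compact group in which 1 is isolated is finite.

If the natural map is a homeomorphism between the smooth parts, its fibres
there are singletons, so Z(G) has no element of order 2 and odd order
([odd_centerP]).  Conversely, let |Z(G)| be odd.  Fibres are singletons again,
and every central element is a square, which is what is needed to move a point
x with tau x in K x, inside its orbit, to a tau-fixed point
([natural_map_onto]).  The natural map is then a continuous bijection between
the smooth parts.  Its inverse is continuous because the natural map is closed,
K being compact ([natural_map_closed]), and because the smooth part of
M^tau / K^tau is saturated ([natural_map_smooth]). *)

Set Implicit Arguments.
Unset Strict Implicit.
Unset Printing Implicit Defensive.

Local Open Scope classical_set_scope.
Local Open Scope card_scope.
Local Open Scope ring_scope.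

(** * Symmetry of second derivatives *)

Section SecondDerivatives.
Context (R : realType) (V : normedModType R).

Lemma differentiable_estimate (W : normedModType R) (F : V -> W) (x : V) (e : R) :
  differentiable F x -> 0 < e ->
  \forall k \near (0 : V), `|F (k + x) - F x - 'd F x k| <= e * `|k|.
Proof.
move=> dF e0; have /diff_locally := dF.
move=> /eqaddoP /(_ e e0); apply: filterS => k /=.
by rewrite /= !fctE opprD addrA.
Qed.

Lemma coord_norm_le p (w : 'rV[R]_p) j : `|w ord0 j| <= `|w|.
Proof.
rewrite [leRHS]/Num.Def.normr /= mx_normrE; apply/bigmax_geP; right => /=.
by exists (ord0, j).
Qed.

(** The second difference of f along a and b is h^2 D_b (D_a f) + o(h^2): the
mean value theorem in the direction a turns it into h times an increment of
D_a f along b, which differentiability of D_a f at x controls.  The mean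
value theorem fails for vector-valued maps, hence the single coordinate j. *)
Lemma second_difference p (f : V -> 'rV[R]_p) (x a b : V) (j : 'I_p) (e : R) :
  (\forall y \near x, differentiable f y) -> differentiable ('D_a f) x -> 0 < e ->
  \forall h \near 0^'+,
    `|(f (x + h *: a + h *: b) - f (x + h *: a) - f (x + h *: b) + f x) ord0 j
      - h ^+ 2 * ('D_b ('D_a f) x) ord0 j| <= e * h ^+ 2.
Proof.
move=> df ddf e0.
pose N := `|a| + `|b|; have N0 : 0 <= N by rewrite addr_ge0.
(* Both points of the increment are within h * N of x, so the two errors add up
   to e1 * (2 * h * N); the + 1 keeps the denominator positive. *)
pose e1 := e / (2 * N + 1).
have e10 : 0 < e1 by rewrite divr_gt0// ltr_pwDr// mulr_ge0.
have near0 : \forall k \near (0 : V), differentiable f (k + x).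
  by move: df; rewrite (near_shift 0 x); apply: filterS => k /=; rewrite subr0.
have est := differentiable_estimate ddf e10.
have /nbhs_norm0P[d /= d0 dP] : \forall k \near (0 : V), differentiable f (k + x) /\
    `|'D_a f (k + x) - 'D_a f x - 'd ('D_a f) x k| <= e1 * `|k|.
  by apply: filterS2 near0 est => k.
have {}dP k : `|k| < d -> differentiable f (k + x) /\
    `|'D_a f (k + x) - 'D_a f x - 'd ('D_a f) x k| <= e1 * `|k|.
  by move=> kd; exact: dP.
near=> h.
have h0 : 0 < h by near: h; exact: nbhs_right_gt.
have hd : h * (N + 1) < d.
  rewrite -ltr_pdivlMr ?ltr_pwDr//; near: h; apply: nbhs_right_lt.
  by rewrite divr_gt0// ltr_pwDr.
have small s t : 0 <= s <= h -> 0 <= t <= h -> `|s *: a + t *: b| <= h * N.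
  move=> /andP[s0 sh] /andP[t0 th]; rewrite mulrDr (le_trans (ler_normD _ _))//.
  by rewrite !normrZ !ger0_norm// lerD// ler_wpM2r.
have hN s t : 0 <= s <= h -> 0 <= t <= h -> `|s *: a + t *: b| < d.
  move=> s0 t0; apply: le_lt_trans (small _ _ s0 t0) (le_lt_trans _ hd).
  by rewrite ler_wpM2l ?(ltW h0)// lerDl.
have is_deriv t s : 0 <= s <= h -> 0 <= t <= h ->
    is_derive s (1 : R) (fun s => f (s *: a + t *: b + x) ord0 j)
      ('D_a f (s *: a + t *: b + x) ord0 j).
  move=> s0 t0; have [dfy _] := dP _ (hN _ _ s0 t0).
  have dfa : derivable f (s *: a + t *: b + x) a by exact: diff_derivable.
  have dg : derivable (fun s : R => f (s *: a + t *: b + x)) s 1.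
    move: dfa; rewrite /derivable /=.
    under eq_fun do rewrite !addrA -scalerDl -[X in (X + s)]mulr1.
    exact.
  have -> : 'D_a f (s *: a + t *: b + x) = 'D_1 (fun s : R => f (s *: a + t *: b + x)) s.
    rewrite /derive /=.
    under eq_fun do rewrite !addrA -scalerDl -[X in (X + s)]mulr1.
    by [].
  split; first by have /derivable_mxP := dg; exact.
  by rewrite derive_mx// mxE.
(* 0 *: b keeps phi in the form of is_deriv at both ends. *)
pose phi s := f (s *: a + h *: b + x) ord0 j - f (s *: a + 0 *: b + x) ord0 j.
pose dphi s := 'D_a f (s *: a + h *: b + x) ord0 j - 'D_a f (s *: a + 0 *: b + x) ord0 j.
have hh : 0 <= h <= h by rewrite (ltW h0) lexx.
have h00 : (0 : R) <= 0 <= h by apply/andP; split=> //; exact: ltW.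
have dphiP s : 0 <= s <= h -> is_derive s (1 : R) phi (dphi s).
  by move=> s0; apply: is_deriveB; exact: is_deriv.
have [|s|s s0 phiE] := @MVT R phi dphi 0 h h0.
- by move=> s /itvP sI; apply: dphiP; rewrite !sI.
- apply: derivable_within_continuous => {}s sI.
  by apply: ex_derive; apply: dphiP; rewrite !(itvP sI).
have sh : 0 <= s <= h by rewrite !(itvP s0).
have [_ E1] := dP _ (hN _ _ sh hh).
have [_ E0] := dP _ (hN _ _ sh h00).
have -> : (f (x + h *: a + h *: b) - f (x + h *: a) - f (x + h *: b) + f x) ord0 j
    = phi h - phi 0.
  rewrite !mxE /phi !scale0r !addr0 !add0r.
  rewrite -[x + h *: a + _]addrA [x + (_ + _)]addrC ![x + h *: _]addrC.
  by ring.
rewrite phiE subr0 deriveE//.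
have -> : 'd ('D_a f) x b = h^-1 *: ('d ('D_a f) x (s *: a + h *: b)
    - 'd ('D_a f) x (s *: a + 0 *: b)).
  rewrite -linearB /= scale0r addr0 addrAC subrr add0r linearZ /= scalerA.
  by rewrite mulVf ?scale1r// gt_eqF.
set D1 := 'D_a f _ in E1; set D0 := 'D_a f (_ + x) in E0.
set L1 := 'd _ _ _ in E1 *; set L0 := 'd _ _ _ in E0 *.
have -> : dphi s * h - h ^+ 2 * (h^-1 *: (L1 - L0)) ord0 j =
   h * ((D1 - 'D_a f x - L1) ord0 j - (D0 - 'D_a f x - L0) ord0 j).
  rewrite /dphi -/D1 -/D0 !mxE mulrA expr2 mulfK ?gt_eqF//.
  by ring.
have -> : e * h ^+ 2 = h * (e * h) by ring.
rewrite normrM gtr0_norm// ler_pM2l//.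
apply: (le_trans (ler_normB _ _)).
apply: (le_trans (lerD (le_trans (coord_norm_le _ _) E1)
                       (le_trans (coord_norm_le _ _) E0))).
rewrite -mulrDr; apply: (@le_trans _ _ (e1 * (h * N + h * N))).
  by rewrite ler_pM2l// lerD// small.
have -> : e = e1 * (2 * N + 1) by rewrite divfK// gt_eqF// ltr_pwDr// mulr_ge0.
rewrite -mulrA ler_pM2l//; nra.
Unshelve. all: by end_near. Qed.

(** Young's form of the symmetry of second derivatives: the second difference
does not change when a and b are exchanged, and both mixed derivatives are its
limit after division by h^2. *)
Lemma mixed_derive_sym p (f : V -> 'rV[R]_p) (x a b : V) :
  (\forall y \near x, differentiable f y) ->
  differentiable ('D_a f) x -> differentiable ('D_b f) x ->
  'D_b ('D_a f) x = 'D_a ('D_b f) x.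
Proof.
move=> df da db; apply/rowP => j; apply/eqP; rewrite -subr_eq0 -normr_le0.
apply/ler_addgt0Pl => e e0; rewrite addr0.
have e20 : 0 < e / 2 by rewrite divr_gt0.
pose Q h u v := (f (x + h *: u + h *: v) - f (x + h *: u) - f (x + h *: v) + f x) ord0 j.
have Hab : \forall h \near 0^'+,
    `|Q h a b - h ^+ 2 * ('D_b ('D_a f) x) ord0 j| <= e / 2 * h ^+ 2.
  exact: second_difference.
have Hba : \forall h \near 0^'+,
    `|Q h b a - h ^+ 2 * ('D_a ('D_b f) x) ord0 j| <= e / 2 * h ^+ 2.
  exact: second_difference.
have [h [[A B] h0]] := filter_ex (filterI (filterI Hab Hba) (nbhs_right_gt 0)).
have h20 : 0 < h ^+ 2 by rewrite exprn_gt0.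
rewrite -(ler_pM2l h20) -{1}(gtr0_norm h20) -normrM.
have QC : Q h a b = Q h b a by rewrite /Q [x + h *: b + _]addrAC !mxE; ring.
rewrite QC in A.
have split_diff (q s u v : R) : s * (u - v) = (q - s * v) - (q - s * u) by ring.
rewrite (split_diff (Q h b a)) (le_trans (ler_normB _ _))//.
rewrite (le_trans (lerD B A))// -mulrDl -splitr mulrC//.
Qed.

End SecondDerivatives.

(** * Continuity and closedness *)

Lemma within_continuous_open (X Y : topologicalType) (A : set X) (f : X -> Y) x :
  open A -> {within A, continuous f} -> A x -> {for x, continuous f}.
Proof.
by move=> oA; rewrite continuous_open_subspace// => cf Ax; apply: cf; exact/mem_set.
Qed.

Lemma row_entry_continuous (T : topologicalType) N (j : 'I_N) :
  continuous (fun M : 'rV[T]_N => M ord0 j).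
Proof.
move=> M A MA; exists (fun _ j' => if j' == j then A else setT).
  by move=> i j'; rewrite ord1; case: eqP => [->|_]; [exact: MA|exact: filterT].
by move=> M' /(_ ord0 j); rewrite eqxx.
Qed.

Lemma continuous_row (X T : topologicalType) N (f : X -> 'rV[T]_N) :
  (forall j, continuous (fun x => f x ord0 j)) -> continuous f.
Proof.
move=> fc x A [P Px PA].
have : \forall y \near x, forall j, P ord0 j (f y ord0 j).
  by apply: filter_forall => j; apply: fc; exact: Px.
by apply: filterS => y Py; apply: PA => i j; rewrite ord1; exact: Py.
Qed.

Lemma continuous_pair (X T U : topologicalType) (f : X -> T) (g : X -> U) :
  continuous f -> continuous g -> continuous (fun x => (f x, g x)).
Proof. by move=> fc gc x; apply: cvg_pair; [exact: fc|exact: gc]. Qed.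

Lemma fst_continuous (T U : topologicalType) : continuous (@fst T U).
Proof. by move=> ?; exact: cvg_fst. Qed.

Lemma snd_continuous (T U : topologicalType) : continuous (@snd T U).
Proof. by move=> ?; exact: cvg_snd. Qed.

Lemma continuous_fcomp (X T U : topologicalType) (f : X -> T) (g : T -> U) :
  continuous g -> continuous f -> continuous (fun x => g (f x)).
Proof. by move=> gc fc x; exact: continuous_comp (fc x) (gc (f x)). Qed.

Lemma closed_equalizer (X T : topologicalType) (f g : X -> T) :
  hausdorff_space T -> continuous f -> continuous g ->
  closed [set x | f x = g x].
Proof.
move=> hT fc gc x clx; apply: hT => A B fA gB.
have nA : nbhs x (f @^-1` A) by exact: fc.
have nB : nbhs x (g @^-1` B) by exact: gc.
have [y [/= fgy [Ay By]]] := clx _ (filterI nA nB).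
by exists (f y); split; [exact: Ay|rewrite fgy; exact: By].
Qed.

Section LieContinuity.
Context (R : realType) (n : nat) (G : lieGroupType R n).

Lemma continuous_mulg (X : topologicalType) (f g : X -> G) :
  continuous f -> continuous g -> continuous (fun x => f x * g x)%g.
Proof.
move=> fc gc.
exact: continuous_fcomp (@lie_mul_continuous _ _ G) (continuous_pair fc gc).
Qed.

Lemma continuous_invg (X : topologicalType) (f : X -> G) :
  continuous f -> continuous (fun x => (f x)^-1)%g.
Proof. exact: continuous_fcomp (@lie_inv_continuous _ _ G). Qed.

End LieContinuity.

(** * Squares and involutions in the centre *)

Lemma card_fibres (T U : choiceType) (A : set T) (f : T -> U) (m k n : nat) :
  A #= `I_m -> f @` A #= `I_n ->
  (forall x, A x -> [set y | A y /\ f y = f x] #= `I_k) -> m = (n * k)%N.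
Proof.
move=> Am fn fibre_k; have A_fin : finite_set A by exists m.
rewrite -(card_fset_set Am) -(card_fset_set fn) fset_set_image//.
rewrite card_fset_sum1 (partition_big_imfset _ f) /=.
transitivity (\sum_(j <- [fset f x | x in fset_set A]%fset) k)%N; last first.
  by rewrite big_const_seq count_predT iter_addn_0 mulnC.
rewrite big_seq [RHS]big_seq; apply: eq_bigr => _ /imfsetP[x /= + ->].
rewrite in_fset_set// => /set_mem Ax.
rewrite -big_filter sum1_size -(card_fset_set (fibre_k x Ax)).
apply: perm_size; apply: uniq_perm; rewrite ?filter_uniq ?fset_uniq// => y.
rewrite mem_filter in_fset_set// in_fset_set//; last by exists k; exact: fibre_k.
apply/idP/idP => [/andP[/eqP fyx /set_mem Ay]|/set_mem[Ay ->]].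
  exact: mem_set.
by rewrite eqxx mem_set.
Qed.

Lemma card_set2 (T : choiceType) (x y : T) : x <> y -> [set x; y] #= `I_2.
Proof.
move=> xy; have -> : [set x; y] = [set` [fset x; y]%fset].
  apply/seteqP; split=> z /=; rewrite !inE; first by case=> ->; rewrite eqxx ?orbT.
  by case/orP=> /eqP; [left|right].
by apply/card_eq_fsetP; rewrite cardfs2; case: eqP.
Qed.

(** The fibres of x |-> {x, s x} have two elements. *)
Lemma involution_parity (T : choiceType) (A : set T) (s : T -> T) (m : nat) :
  A #= `I_m -> (forall x, A x -> [/\ A (s x), s (s x) = x & s x <> x]) -> ~~ odd m.
Proof.
move=> Am sP; pose f x := [set x; s x].
have [n fn] : finite_set (f @` A) by apply: finite_image; exists m.
rewrite (card_fibres Am fn (k := 2)) ?oddM ?andbF// => x Ax.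
have [Asx ssx sx] := sP x Ax.
rewrite (_ : [set y | _] = [set x; s x]); first by apply: card_set2 => /esym.
apply/seteqP; split=> [y [Ay fyx]|y [->|->]].
- by rewrite [_ y](_ : _ = f x y)// -fyx; left.
- by [].
- by split=> //; rewrite /f ssx setUC.
Qed.

Section CenterCounting.
Context (G : groupType).
Local Open Scope group_scope.
Local Notation Z := (group_center G).
Local Notation Q := (@center_squares G).

Lemma center1 : Z 1. Proof. by move=> g; rewrite mul1g mulg1. Qed.

Lemma centerM z w : Z z -> Z w -> Z (z * w).
Proof. by move=> zC wC g; rewrite -mulgA (wC g) mulgA (zC g) mulgA. Qed.

Lemma centerV z : Z z -> Z z^-1.
Proof. by move=> zC g; apply: (mulgI z); rewrite mulgA mulgV mul1g mulgA zC mulgK. Qed.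

(** The kernel of squaring on the centre; it contains 1. *)
Definition center_involutions : set G := [set z | Z z /\ z * z = 1].

Lemma center_squares_sub z : Q z -> Z z.
Proof. by move=> [s sC <-]; exact: centerM. Qed.

Lemma center_squaresM z w :
  Q z -> Q w -> center_squares (z * w).
Proof.
move=> [s sC <-] [t tC <-]; exists (s * t); first exact: centerM.
by rewrite -!mulgA; congr (_ * _); rewrite !mulgA (tC s).
Qed.

Lemma center_squaresV z : Q z -> Q z^-1.
Proof. by move=> [s sC <-]; exists s^-1; rewrite ?invgM//; exact: centerV. Qed.

Lemma squaring_fibre x : Z x ->
  [set y | Z y /\ y * y = x * x] #= center_involutions.
Proof.
move=> xC; rewrite (_ : [set y | _] = [set x * z | z in center_involutions]).
  by apply: inj_card_eq => y z _ _ /mulgI.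
apply/seteqP; split=> [y [yC yx]|_ [z [zC zz] <-]]; last first.
  split; first exact: centerM.
  by rewrite -mulgA [z * _]mulgA (zC x) -[x * z * z]mulgA zz mulg1.
exists (x^-1 * y); last by rewrite mulgA mulgV mul1g.
split; first exact: centerM (centerV xC) yC.
by rewrite -mulgA [y * _]mulgA (yC x^-1) -[x^-1 * y * y]mulgA yx mulKg mulVg.
Qed.

Lemma coset_fibre x : Z x ->
  [set y | Z y /\ [set y * w | w in Q] = [set x * w | w in Q]] #= Q.
Proof.
move=> xC; rewrite (_ : [set y | _] = [set x * w | w in Q]).
  by apply: inj_card_eq => y z _ _ /mulgI.
have sq1 : Q 1 by exists 1; rewrite ?mulg1//; exact: center1.
apply/seteqP; split=> [y [yC <-]|_ [w wsq <-]]; first by exists 1; rewrite ?mulg1.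
split; first exact: centerM xC (center_squares_sub wsq).
apply/seteqP; split=> [_ [v vsq <-]|_ [v vsq <-]].
  by exists (w * v); rewrite ?mulgA//; exact: center_squaresM.
exists (w^-1 * v); first by apply: center_squaresM => //; exact: center_squaresV.
by rewrite -mulgA [w * _]mulgA mulgV mul1g.
Qed.

Hypothesis Z_finite : finite_set Z.

(** Two maps on the finite group Z have fibres of constant size: squaring, with
image Q and fibres the cosets of its kernel, and the projection to Z / Q, with
fibres the cosets of Q.  Hence |Q| t = |Z| = |Z / Q| |Q|, where t is the order
of the kernel. *)
Lemma card_center_involutions : center_involutions #= center_mod_squares G.
Proof.
have [m Zm] := Z_finite.
have [t It] : finite_set center_involutions.
  by apply: sub_finite_set Z_finite => z [].
have [s Ss] : finite_set Q.
  exact: sub_finite_set center_squares_sub Z_finite.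
have [q Cq] : finite_set (center_mod_squares G).
  exact: finite_image.
have mst : m = (s * t)%N.
  apply: (card_fibres Zm Ss) => x xC.
  by rewrite (card_eql (squaring_fibre xC)).
have mqs : m = (q * s)%N.
  apply: (card_fibres Zm Cq) => x xC.
  by rewrite (card_eql (coset_fibre xC)).
have s0 : (0 < s)%N.
  rewrite lt0n; apply/eqP => s0; move: Ss; rewrite s0 II0 card_eq0 => /eqP/seteqP[+ _].
  by move=> /(_ 1); apply; exists 1; rewrite ?mulg1//; exact: center1.
have tq : t = q by apply/eqP; rewrite -(eqn_pmul2l s0) -mst mqs mulnC.
by rewrite (card_eql It) card_eq_sym (card_eql Cq) tq.
Qed.

(** A nontrivial involution t pairs z with t z, so |Z| is even.  Without one,
inversion pairs off the elements other than 1, so |Z| is odd. *)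
Lemma odd_centerP : odd_card Z <-> center_involutions `<=` [set 1].
Proof.
split=> [[m m_odd Zm] t [tC tt]|no_inv].
  apply: contrapT => t1; move: m_odd; apply/negP.
  apply: (involution_parity (s := fun z => t * z) Zm) => x xC; split.
  - exact: centerM.
  - by rewrite mulgA tt mul1g.
  - by move=> tx; apply: t1; apply: (mulIg x); rewrite mul1g.
have [m Zm] := Z_finite; exists m => //.
have Z1_fin : finite_set (Z `\ 1) by exact: finite_setD.
have [k Z1k] := Z1_fin.
have -> : m = k.+1.
  rewrite -(card_fset_set Zm) -(card_fset_set Z1k) fset_setD1//.
  by rewrite (cardfsD1 1) in_fset_set// mem_set//; exact: center1.
rewrite /= (involution_parity (s := fun z => z^-1) Z1k)// => x [xC x1]; split.
- by split; [exact: centerV | move=> xV; apply: x1; rewrite /= -(invgK x) xV invg1].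
- exact: invgK.
- by move=> xV; apply: x1; apply: no_inv; split=> //; rewrite -{1}xV mulVg.
Qed.

(** Squaring is injective on the finite group Z, which has no nontrivial involution,
so it is onto. *)
Lemma odd_center_squares : odd_card Z -> Z `<=` Q.
Proof.
move=> /odd_centerP no_inv; have [m Zm] := Z_finite.
have S_fin : finite_set Q.
  exact: sub_finite_set center_squares_sub Z_finite.
have SZ : Q #= Z.
  apply: inj_card_eq => x y /set_mem xC /set_mem yC xy.
  suff : y^-1 * x = 1 by move=> yx; rewrite -[RHS]mulg1 -yx mulgA mulgV mul1g.
  apply: no_inv; split; first exact: centerM (centerV yC) xC.
  by rewrite -mulgA [x * _]mulgA (xC y^-1) -[y^-1 * x * x]mulgA xy mulKg mulVg.
have cards := elimT (fcard_eq S_fin Z_finite) SZ.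
have sub : (fset_set Q `<=` fset_set Z)%fset.
  by rewrite -fset_set_sub//; exact: center_squares_sub.
move=> z zC; have := (fsubset_cardP cards sub) z.
by rewrite !in_fset_set// (mem_set zC) => /set_mem.
Qed.

End CenterCounting.

(** * Finiteness of the centre *)

(** A directional derivative depends only on the values along the line. *)
Lemma derive_line_ext (R : realType) (V V' W : normedModType R)
    (f : V -> W) (g : V' -> W) a v b w :
  (forall h : R, f (h *: v + a) = g (h *: w + b)) -> 'D_v f a = 'D_w g b.
Proof.
move=> fg; have fg0 : f a = g b by have := fg 0; rewrite !scale0r !add0r.
by rewrite /derive /=; under eq_fun do rewrite fg fg0.
Qed.

Section LieCenter.
Context (R : realType) (n : nat) (G : lieGroupType R n) (c : chart R n G).
Hypotheses (c_atlas : atlas c) (c1 : chart_dom c 1%g).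

Local Notation e := (c 1%g).
Local Notation e2 := (row_mx e e : 'rV[R]_(n + n)).

Definition chart_mul (w : 'rV[R]_(n + n)) : 'rV[R]_n :=
  c (chart_inv c (lsubmx w) * chart_inv c (rsubmx w))%g.

Definition inl_row (v : 'rV[R]_n) : 'rV[R]_(n + n) := row_mx v 0.
Definition inr_row (v : 'rV[R]_n) : 'rV[R]_(n + n) := row_mx 0 v.

Lemma inl_row_norm v : `|inl_row v| <= `|v|.
Proof.
rewrite [leLHS]/Num.Def.normr /= mx_normrE; apply/bigmax_leP; split=> // -[i j] _ /=.
rewrite mxE; case: splitP => k _; rewrite ?mxE ?normr0// ord1 coord_norm_le//.
Qed.

Lemma inr_row_norm v : `|inr_row v| <= `|v|.
Proof.
rewrite [leLHS]/Num.Def.normr /= mx_normrE; apply/bigmax_leP; split=> // -[i j] _ /=.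
rewrite mxE; case: splitP => k _; rewrite ?mxE ?normr0// ord1 coord_norm_le//.
Qed.

Lemma chart_invK x : chart_dom c x -> chart_inv c (c x) = x.
Proof. by case: (chart_homeo c) => _ _ + _ _; apply. Qed.

Lemma chart_cod1 : chart_cod c e.
Proof. by case: (chart_homeo c) => + _ _ _ _; apply. Qed.

Lemma chart_continuous x : chart_dom c x -> {for x, continuous c}.
Proof.
move=> cx; case: (chart_homeo c) => _ _ _ _ [cc _].
exact: (within_continuous_open (chart_dom_open c) cc cx).
Qed.

Lemma chart_inv_continuous u : chart_cod c u -> {for u, continuous (chart_inv c)}.
Proof.
move=> cu; case: (chart_homeo c) => _ _ _ _ [_ cc].
exact: (within_continuous_open (@chart_cod_open _ _ _ c) cc cu).
Qed.

Lemma lsubmx_continuous : continuous (lsubmx : 'rV[R]_(n + n) -> 'rV[R]_n).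
Proof. move=> x; exact/differentiable_continuous/differentiable_lsubmx. Qed.

Lemma rsubmx_continuous : continuous (rsubmx : 'rV[R]_(n + n) -> 'rV[R]_n).
Proof. move=> x; exact/differentiable_continuous/differentiable_rsubmx. Qed.

Lemma chart_mul_C2 :
  (\forall w \near e2, differentiable chart_mul w) /\
  (forall v, differentiable ('D_v chart_mul) e2).
Proof.
have [] := lie_mul_smooth _ _ _ c_atlas c_atlas c_atlas 2.
set U := [set w | _] => dU ddU.
have lE : lsubmx e2 = e by rewrite row_mxKl.
have rE : rsubmx e2 = e by rewrite row_mxKr.
have oc := @chart_cod_open _ _ _ c; have od := chart_dom_open c.
have Ue2 : U e2.
  by rewrite /U /= lE rE chart_invK// mulg1; split=> //; exact: chart_cod1.
split; last by move=> v; have [] := ddU v; move=> + _; apply.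
have nl : \forall w \near e2, chart_cod c (lsubmx w).
  apply: lsubmx_continuous; apply: open_nbhs_nbhs; rewrite lE.
  by split => //; exact: chart_cod1.
have nr : \forall w \near e2, chart_cod c (rsubmx w).
  apply: rsubmx_continuous; apply: open_nbhs_nbhs; rewrite rE.
  by split => //; exact: chart_cod1.
have nm : \forall w \near e2,
    chart_dom c (chart_inv c (lsubmx w) * chart_inv c (rsubmx w))%g.
  have cl : {for e2, continuous (fun w => chart_inv c (lsubmx w))}.
    apply: continuous_comp; first exact: lsubmx_continuous.
    by apply: chart_inv_continuous; rewrite lE; exact: chart_cod1.
  have cr : {for e2, continuous (fun w => chart_inv c (rsubmx w))}.
    apply: continuous_comp; first exact: rsubmx_continuous.
    by apply: chart_inv_continuous; rewrite rE; exact: chart_cod1.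
  have cm : {for e2, continuous
      (fun w => chart_inv c (lsubmx w) * chart_inv c (rsubmx w))%g}.
    have clr : {for e2, continuous
        (fun w => (chart_inv c (lsubmx w), chart_inv c (rsubmx w)))}.
      exact: cvg_pair cl cr.
    exact: (@continuous_comp _ _ _
      (fun w => (chart_inv c (lsubmx w), chart_inv c (rsubmx w)))
      (fun p : G * G => (p.1 * p.2)%g) e2 clr (@lie_mul_continuous _ _ G _)).
  by apply: cm; apply: open_nbhs_nbhs; case: Ue2.
by apply: filterS3 nl nr nm => w wl wr wm; apply: dU.
Qed.

Lemma derive_mulr x y v : 'D_v (fun y => c (chart_inv c x * chart_inv c y)%g) y =
  'D_(inr_row v) chart_mul (row_mx x y).
Proof.
apply: derive_line_ext => h.
by rewrite /chart_mul /inr_row scale_row_mx scaler0 add_row_mx add0r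
  !row_mxKl !row_mxKr.
Qed.

Lemma derive_mull x y v : 'D_v (fun x => c (chart_inv c x * chart_inv c y)%g) x =
  'D_(inl_row v) chart_mul (row_mx x y).
Proof.
apply: derive_line_ext => h.
by rewrite /chart_mul /inl_row scale_row_mx scaler0 add_row_mx add0r
  !row_mxKl !row_mxKr.
Qed.

Lemma lie_bracketE u v : lie_bracket c u v =
  'D_(inl_row u) ('D_(inr_row v) chart_mul) e2
  - 'D_(inl_row v) ('D_(inr_row u) chart_mul) e2.
Proof.
have H a b : 'D_a (fun x => 'D_b (fun y => c (chart_inv c x * chart_inv c y)%g) e) e =
    'D_(inl_row a) ('D_(inr_row b) chart_mul) e2.
  apply: derive_line_ext => h; rewrite !derive_mulr.
  by rewrite /inl_row scale_row_mx scaler0 add_row_mx add0r.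
by rewrite /lie_bracket !H.
Qed.

(** The derivative at e, in the direction t, of
x |-> D_v (mu (x, -)) e - D_v (mu (-, x)) e, where mu is the group law read in
the chart.  This function vanishes at central points, while its derivative is
the bracket (bracket_formE). *)
Definition bracket_form (v t : 'rV[R]_n) : 'rV[R]_n :=
  'd ('D_(inr_row v) chart_mul) e2 (inl_row t)
  - 'd ('D_(inl_row v) chart_mul) e2 (inr_row t).

(** The two definitions differ by the order of differentiation in the second
term, so this is the symmetry of second derivatives. *)
Lemma bracket_formE v t : bracket_form v t = lie_bracket c t v.
Proof.
have [d1 d2] := chart_mul_C2.
rewrite lie_bracketE /bracket_form; congr (_ - _).
  exact/esym/deriveE/d2.
transitivity ('D_(inr_row t) ('D_(inl_row v) chart_mul) e2).
  exact/esym/deriveE/d2.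
by apply: mixed_derive_sym.
Qed.

Lemma inl_rowZ a v : inl_row (a *: v) = a *: inl_row v.
Proof. by rewrite /inl_row scale_row_mx scaler0. Qed.

Lemma inr_rowZ a v : inr_row (a *: v) = a *: inr_row v.
Proof. by rewrite /inr_row scale_row_mx scaler0. Qed.

Lemma bracket_formZ v a t : bracket_form v (a *: t) = a *: bracket_form v t.
Proof.
rewrite /bracket_form inl_rowZ inr_rowZ scalerBr.
by congr (_ - _); exact: linearZZ.
Qed.

Lemma bracket_form_continuous v : continuous (bracket_form v).
Proof.
have [_ d2] := chart_mul_C2.
have rmx_cont (g : 'rV[R]_n -> 'rV[R]_(n + n)) :
    (forall t, `|g t| <= `|t|) -> {morph g : x y / x - y} -> continuous g.
  move=> gn gB t; apply/(@cvgrPdist_lt _ _ _ (nbhs t)) => eps eps0.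
  apply: filterS (nbhsx_ballx t eps eps0) => s; rewrite -ball_normE /= => ts.
  by rewrite -gB (le_lt_trans (gn _)).
have cl : continuous inl_row.
  apply: rmx_cont inl_row_norm _ => x y.
  by rewrite /inl_row opp_row_mx add_row_mx subr0.
have cr : continuous inr_row.
  apply: rmx_cont inr_row_norm _ => x y.
  by rewrite /inr_row opp_row_mx add_row_mx subr0.
have dl : continuous ('d ('D_(inr_row v) chart_mul) e2) by exact: diff_continuous.
have dr : continuous ('d ('D_(inl_row v) chart_mul) e2) by exact: diff_continuous.
by move=> t; apply: (@cvgB _ _ _ (nbhs t));
  [exact: cvg_comp (cl t) (dl _) | exact: cvg_comp (cr t) (dr _)].
Qed.

(** For z central, y |-> z y and y |-> y z are the same map. *)
Lemma derive_central z v : group_center G z -> chart_dom c z ->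
  'D_(inr_row v) chart_mul (row_mx (c z) e) =
  'D_(inl_row v) chart_mul (row_mx e (c z)).
Proof.
move=> zC cz; rewrite -derive_mulr -derive_mull; apply: derive_line_ext => h.
by rewrite !chart_invK// zC.
Qed.

(** The function that bracket_form differentiates is zero at e and at c z, so
its linear part on c z - e is no larger than the remainder. *)
Lemma bracket_form_central v (eps : R) : 0 < eps ->
  \forall z \near 1%g, group_center G z ->
    `|bracket_form v (c z - e)| <= eps * `|c z - e|.
Proof.
move=> eps0; have [_ d2] := chart_mul_C2.
have e20 : 0 < eps / 2 by rewrite divr_gt0.
have /nbhs_norm0P[r1 /= r10 Er] := differentiable_estimate (d2 (inr_row v)) e20.
have /nbhs_norm0P[r2 /= r20 El] := differentiable_estimate (d2 (inl_row v)) e20.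
have cc := chart_continuous c1.
have near_small r : 0 < r -> \forall z \near 1%g, `|c z - e| < r.
  move=> r0; have := @cvgrPdist_lt _ _ _ (nbhs (1%g : G)) _ c e => -[/(_ cc) + _].
  by move=> /(_ _ r0); apply: filterS => z; rewrite distrC.
have near_dom : \forall z \near (1%g : G), chart_dom c z.
  by apply: open_nbhs_nbhs; split => //; exact: chart_dom_open.
apply: filterS3 (near_small _ r10) (near_small _ r20) near_dom => z zr1 zr2 cz zC.
have /= := Er _ (le_lt_trans (inl_row_norm _) zr1).
have /= := El _ (le_lt_trans (inr_row_norm _) zr2).
have -> : inl_row (c z - e) + e2 = row_mx (c z) e.
  by rewrite /inl_row add_row_mx subrK add0r.
have -> : inr_row (c z - e) + e2 = row_mx e (c z).
  by rewrite /inr_row add_row_mx subrK add0r.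
rewrite !derive_central//; last by move=> g; rewrite mul1g mulg1.
set A := 'D_(inl_row v) chart_mul (row_mx e (c z)) - _ => E2 E1.
have via (a b : 'rV[R]_n) : a - b = (A - b) - (A - a).
  by rewrite opprB [RHS]addrC addrA subrK.
rewrite /bracket_form [X in `|X| <= _]via; apply: (le_trans (ler_normB _ _)).
apply: (le_trans (lerD E2 E1)).
rewrite [eps in leRHS]splitr mulrDl lerD// ler_pM2l//.
  exact: inr_row_norm.
exact: inl_row_norm.
Qed.

(** Otherwise central z <> 1 tend to 1, and the unit vectors along c z - e
accumulate at some u by compactness of the sphere.  Every bracket_form v is
continuous and tends to 0 along these vectors, so it kills u: the line
spanned by u is central in the Lie algebra, an abelian ideal that
semisimplicity excludes. *)
Lemma center_isolated : semisimple_bracket (lie_bracket c) ->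
  \forall z \near (1%g : G), group_center G z -> z = 1%g.
Proof.
move=> ss; apply: contrapT => not_isolated.
pose F := within [set z | group_center G z /\ z <> 1%g] (nbhs (1%g : G)).
have FF : ProperFilter F.
  split; last exact: within_filter.
  move=> F0; apply: not_isolated; move: F0; rewrite /F /within /=.
  apply: filterS => z /= z1 zC.
  by apply: contrapT => zN; apply: z1.
pose dir z := `|c z - e|^-1 *: (c z - e).
have near_dom : \forall z \near F, chart_dom c z.
  by apply: cvg_within; apply: open_nbhs_nbhs; split => //; exact: chart_dom_open.
have near_center : \forall z \near F, group_center G z /\ z <> 1%g.
  exact: withinT.
have sphere_compact : compact [set t : 'rV[R]_n | `|t| = 1].
  apply: bounded_closed_compact.
    by exists 1; split=> // M M1 t /= ->; exact: ltW.
  rewrite (_ : [set t | _] = (@Num.Def.normr _ 'rV[R]_n) @^-1` [set 1])//.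
  apply: preimage_closed; first by move=> t _; exact: norm_continuous.
  exact: closed_eq.
have dir_sphere : \forall z \near F, `|dir z| = 1.
  apply: filterS2 near_dom near_center => z cz [_ z1].
  rewrite normrZ normfV normr_id mulVf// normr_eq0 subr_eq0.
  by apply: contra_notN z1 => /eqP ce; rewrite -(chart_invK cz) ce chart_invK.
have [u [/= u1 u_cluster]] := sphere_compact (dir @ F) _ dir_sphere.
have form_u v : bracket_form v u = 0.
  apply/eqP; rewrite -normr_le0 leNgt; apply/negP => fu0.
  have e0 : 0 < `|bracket_form v u| / 2 by rewrite divr_gt0.
  have far : \forall t \near u, `|bracket_form v u| / 2 < `|bracket_form v t|.
    have cn : {for u, continuous (fun t => `|bracket_form v t|)}.
      by apply: (@cvg_norm _ _ _ (nbhs u)); exact: bracket_form_continuous.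
    apply: (@cvgr_gt _ _ (nbhs u) _ _ _ cn).
    by rewrite ltr_pdivrMr// ltr_pMr// ltr1n.
  have close : \forall t \near dir @ F,
      `|bracket_form v t| <= `|bracket_form v u| / 2.
    have small : \forall z \near F, group_center G z ->
        `|bracket_form v (c z - e)| <= `|bracket_form v u| / 2 * `|c z - e|.
      by apply: cvg_within; exact: bracket_form_central.
    apply: filterS3 near_center dir_sphere small => z [zC z1] dz /(_ zC) sz.
    rewrite /= /dir bracket_formZ normrZ normfV normr_id mulrC ler_pdivrMr//.
    rewrite lt_neqAle normr_ge0 andbT eq_sym; apply/eqP => cz0.
    by move: dz; rewrite /dir cz0 invr0 scale0r normr0 => /esym/eqP; rewrite oner_eq0.
  have [t [/= tc tf]] := u_cluster _ _ close far.
  by move: tf; rewrite ltNge tc.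
have br0 x y : y \in <[u]>%VS -> lie_bracket c x y = 0.
  move=> /vlineP[a ->].
  have : lie_bracket c (a *: u) x = 0.
    by rewrite -bracket_formE bracket_formZ form_u scaler0.
  by rewrite /lie_bracket => /eqP; rewrite subr_eq0 => /eqP ->; rewrite subrr.
have : <[u]>%VS = 0%VS.
  apply: ss; first by move=> x y /br0 ->; exact: mem0v.
  exists 1%N; apply/eqP; rewrite /= -subv0.
  apply/span_subvP => _ /allpairsP[[x y] [/= xu yu ->]].
  by rewrite br0 ?mem0v// vbasis_mem.
move=> /eqP; rewrite -dimv_eq0 dim_vline eqb0 negbK => /eqP u0.
by move: u1; rewrite u0 normr0 => /esym/eqP; rewrite oner_eq0.
Qed.

End LieCenter.

(** Division translates the isolation of 1 in the centre to every point of G: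
each g has a neighbourhood V with at most one central element.  Were the centre
infinite, the filter of sets containing all but finitely many central elements
would cluster somewhere in the compact group, whereas it contains the
complement in the centre of such a V. *)
Lemma center_finite (R : realType) (n : nat) (G : lieGroupType R n) :
  compact [set: G] -> semisimple G -> finite_set (group_center G).
Proof.
move=> cG ssG; have [c c_atlas c1] := atlas_cover (1%g : G).
have isolated := center_isolated c_atlas c1 (ssG c c_atlas c1).
have div_continuous : continuous (fun p : G * G => (p.1^-1 * p.2)%g).
  exact: continuous_mulg (continuous_invg (@fst_continuous _ _)) (@snd_continuous _ _).
have center_sparse (g : G) : exists2 V : set G, nbhs g V &
    forall x y, V x -> V y -> group_center G x -> group_center G y -> x = y.
  have /(div_continuous (g, g)) : nbhs ((g, g).1^-1 * (g, g).2)%g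
      [set z | group_center G z -> z = 1%g].
    by rewrite mulVg.
  move=> [[P Q] [/= Pg Qg] PQ]; exists (P `&` Q); first exact: filterI.
  move=> x y [Px _] [_ Qy] xC yC; apply: (mulgI x^-1)%g; rewrite mulVg.
  by apply/esym/(PQ (x, y)) => //; exact: centerM (centerV xC) yC.
apply: contrapT => infinite_center.
pose F := [set A : set G | finite_set (group_center G `\` A)].
have FF : ProperFilter F.
  split; first by rewrite /F /= setD0.
  split=> [|A B FA FB|A B AB FA]; rewrite /F /=.
  - by rewrite setDT; exact: finite_set0.
  - by rewrite setDIr finite_setU.
  - by apply: sub_finite_set FA; exact: setDS.
have [g [_ g_cluster]] := cG F _ filterT.
have [V gV V_sparse] := center_sparse g.
have F_off : F (group_center G `\` V).
  rewrite /F /= setDD; have [->|/set0P[x [xC Vx]]] := eqVneq (group_center G `&` V) set0.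
    exact: finite_set0.
  by apply: sub_finite_set (finite_set1 x) => y [yC Vy]; exact: V_sparse.
by have [z [[]]] := g_cluster _ _ F_off gV.
Qed.

(** * The action of K and generic points *)

Section Generic.
Context (G : groupType) (N : nat).
Local Open Scope group_scope.
Implicit Types (x : config G N) (k : G * G).

Lemma generic_stab x k :
  generic x -> act k x = x -> exists2 z, group_center G z & k = (z, z).
Proof.
move=> gx kx; have : [set k | act k x = x] k by [].
by rewrite gx => -[z zC <-]; exists z.
Qed.

Lemma generic_central x z : generic x -> group_center G z -> act (z, z) x = x.
Proof.
move=> gx zC; have : [set (z, z) | z in group_center G] (z, z) by exists z.
by rewrite -gx.
Qed.

(** Stabilizers along an orbit are conjugate, and the diagonal centre is fixed by
conjugation. *)
Lemma generic_act k x : generic x -> generic (act k x).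
Proof.
move=> gx; apply/seteqP; split=> [h /= hkx|_ [z zC <-]] /=.
  have : act (k^-1 * h * k) x = x by rewrite -!actM hkx actM mulVg act1.
  move=> /(generic_stab gx)[z zC kz]; exists z => //.
  have -> : h = k * (k^-1 * h * k) * k^-1 by rewrite !mulgA mulgV mul1g mulgK.
  by rewrite kz; case: (k) => k1 k2; congr (_, _) => /=; rewrite -zC mulgK.
have -> : act (z, z) (act k x) = act k (act (z, z) x).
  by rewrite !actM; congr (act (_, _) x); rewrite /= zC.
by rewrite (generic_central gx).
Qed.

Lemma conj_prod (I : Type) (r : seq I) (F : I -> G) (g : G) :
  \prod_(i <- r) (g * F i * g^-1) = g * \prod_(i <- r) F i * g^-1.
Proof.
elim: r => [|i r IH]; first by rewrite !big_nil mulg1 mulgV.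
by rewrite !big_cons IH !mulgA mulgVK.
Qed.

Lemma surface_word_conj l (V : 'rV[G]_(l + l)) (g : G) :
  surface_word (conj_row g V) = g * surface_word V * g^-1.
Proof.
rewrite /surface_word -conj_prod; apply: eq_bigr => i _.
by rewrite /comm !mxE !invgM !invgK !mulgA !mulgVK.
Qed.

End Generic.

Lemma rep_set_act (G : groupType) (S : nonorientable_surface) (k : G * G)
  (x : config G (width S)) : rep_set x -> rep_set (act k x).
Proof.
case: k => g h.
case: S x => l [[V c] [V' c']] /= [E E'].
  by rewrite !surface_word_conj E E' !mulgA !mulgVK.
have sub_l (a : G) W :
    lsubmx (conj_row a W) = conj_row a (lsubmx W) :> 'rV[G]_(l + l).
  by rewrite /conj_row map_lsubmx.
have sub_r (a : G) (W : 'rV[G]_(l + l + 1)) :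
    rsubmx (conj_row a W) ord0 ord0 = (a * rsubmx W ord0 ord0 * a^-1)%g.
  by rewrite !mxE.
by rewrite !sub_l !sub_r !surface_word_conj E E' !invgM !invgK !mulgA !mulgVK.
Qed.

(** * Fibres and image of the natural map *)

Section Fibres.
Context (R : realType) (n : nat) (G : lieGroupType R n).
Context (S : nonorientable_surface).
Local Notation Inv := (@center_involutions G).
Local Notation nat_map := (natural_map G S).

Lemma natural_map_fixed (p : moduli G S) : fixed_locus G S (nat_map p).
Proof.
rewrite -[p]class_reprK natural_mapE /fixed_locus /= tau_moduliE.
congr (cover_class _); apply/val_inj => /=.
by have [] := set_mem (valP (class_repr p)).
Qed.

Lemma rep_fixP (x : rep_fix G S) : tau_config (val x) = val x.
Proof. by have [] := set_mem (valP x). Qed.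

(** tau sends (1, t) x to (t, 1) x, which differs from (1, t) x by the action of
(t, t), as t is its own inverse; and (t, t) fixes x. *)
Lemma rep_fix_set_twist (x : rep_fix G S) t : generic (val x) -> Inv t ->
  act (1%g, t) (val x) \in @rep_fix_set G S.
Proof.
move=> gx [tC tt]; apply/mem_set; split.
  by apply: rep_set_act; have [] := set_mem (valP x).
have := congr1 (act (1%g, t)) (generic_central gx tC); rewrite actM => zx.
apply: etrans (etrans _ zx); first by rewrite /= tau_act rep_fixP.
by congr (act (_, _) _); rewrite /= ?mul1g ?tt.
Qed.

(** The point (1, t) x when it lies in M^tau, as it does by rep_fix_set_twist
for x generic and t a central involution; the default x makes twist total. *)
Definition twist (x : rep_fix G S) (t : G) : rep_fix G S :=
  insubd x (act (1%g, t) (val x)).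

Lemma val_twist x t : generic (val x) -> Inv t ->
  val (twist x t) = act (1%g, t) (val x).
Proof. by move=> gx It; rewrite insubdK//; exact: rep_fix_set_twist. Qed.

Lemma natural_map_twist x t : generic (val x) -> Inv t ->
  nat_map (class (twist x t)) = nat_map (class x).
Proof.
move=> gx It; rewrite !natural_mapE; apply/esym/cover_classP.
by exists (1%g, t); rewrite /= val_twist.
Qed.

(** If (g, g) carries (1, s) x to (1, t) x, then (g, t^-1 g s) fixes x, so it is
diagonal and central: t^-1 g s = g, whence s = t. *)
Lemma twist_inj x : generic (val x) ->
  {in Inv &, injective (fun t => class (twist x t))}.
Proof.
move=> gx s t /set_mem Is /set_mem It /classP[[g h] /(congr1 fst)/= ->].
rewrite !val_twist// actM => gs.
have fix_x : act ((1, t)^-1 * ((g, g) * (1, s)))%g (val x) = val x.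
  by rewrite -actM gs actM mulVg act1.
have [z zC kz] := generic_stab gx fix_x.
have /= gz := congr1 fst kz; have /= tgs := congr1 snd kz.
have {}gz : g = z by rewrite -gz invg1 mul1g mulg1.
apply: (mulgI g); rewrite {2}gz zC -tgs gz mulgA mulgV mul1g//.
Qed.

(** Let (g, h) carry x to the tau-fixed y.  Then (h, g) does so too, hence
(g, h)^-1 (h, g) fixes x and equals some central (z, z): h = g z and g = h z.
So z is an involution, and y = (g, g) (1, z) x. *)
Lemma natural_map_fibre x p : generic (val x) -> nat_map p = nat_map (class x) ->
  exists2 t, Inv t & p = class (twist x t).
Proof.
move=> gx; rewrite -[p]class_reprK; set y := class_repr p.
rewrite !natural_mapE => /esym/cover_classP[[g h] ghx].
have {}ghx : act (g, h) (val x) = val y := ghx.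
have : act (h, g) (val x) = act (g, h) (val x).
  by rewrite ghx -[RHS]rep_fixP -ghx tau_act rep_fixP.
move=> /(congr1 (act (g, h)^-1%g)); rewrite !actM mulVg act1.
move=> /(generic_stab gx)[z zC kz].
have /= gh := congr1 fst kz; have /= hg := congr1 snd kz.
have Iz : Inv z by split=> //; rewrite -{1}gh -hg -mulgA mulVKg mulVg.
exists z => //; apply/esym/classP; exists (g, g) => //.
rewrite val_twist// actM -ghx.
by congr (act (_, _) _); rewrite /= ?mulg1// -gh mulVKg.
Qed.

Lemma fibre_card (p : moduli G S) : smooth_moduli G S p ->
  [set p' | nat_map p' = nat_map p] #= Inv.
Proof.
move=> [x gx <-].
rewrite (_ : [set p' | _] = (fun t => class (twist x t)) @` Inv).
  exact: inj_card_eq (twist_inj gx).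
apply/seteqP; split=> [p'|_ [t It <-]]; last exact: natural_map_twist.
by move=> /(natural_map_fibre gx)[t It ->]; exists t.
Qed.

Lemma twist1 x : twist x 1%g = x.
Proof. by apply/val_inj; rewrite insubdK act1// (valP x). Qed.

Lemma smooth_twist x t : generic (val x) -> Inv t ->
  smooth_moduli G S (class (twist x t)).
Proof.
by move=> gx It; exists (twist x t) => //=; rewrite val_twist//; exact: generic_act.
Qed.

(** Genericity is a property of K-orbits, so the smooth part of the moduli space
is saturated for the natural map. *)
Lemma natural_map_smooth (p : moduli G S) :
  smooth_fixed_locus G S (nat_map p) <-> smooth_moduli G S p.
Proof.
rewrite -[p]class_reprK; set y := class_repr p; rewrite natural_mapE.
split=> [[_ [x /= gx /cover_classP[k kx]]]|[x /= gx]].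
  by exists y => //=; have := generic_act k gx; rewrite kx.
move=> xy; split; first by rewrite -natural_mapE; exact: natural_map_fixed.
by exists (rep_incl x) => //; rewrite -!natural_mapE xy.
Qed.

(** Let (g, h) carry x to tau x.  Then (h g, g h) fixes x, so that h g = g h = w
is central.  If w = s^2 with s central, then (g s^-1, 1) x is fixed by tau: tau
sends it to (1, g s^-1) (g, h) x = (g, s) x = (g s^-1, 1) (s, s) x. *)
Lemma natural_map_onto : odd_card (group_center G) -> finite_set (group_center G) ->
  smooth_fixed_locus G S `<=` nat_map @` smooth_moduli G S.
Proof.
move=> Z_odd Z_fin q [qfix [x /= gx xq]].
move: qfix; rewrite -xq /fixed_locus /= tau_moduliE.
move=> /esym/cover_classP[[g h] ghx].
have {}ghx : act (g, h) (val x) = tau_config (val x) := ghx.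
have tau_tau (y : config G (width S)) : tau_config (tau_config y) = y by case: y.
have : act ((h, g) * (g, h))%g (val x) = val x.
  by rewrite -actM ghx -[RHS]tau_tau -ghx tau_act ghx.
move=> /(generic_stab gx)[w wC kw].
have /= gh := congr1 snd kw.
have [s sC sw] := odd_center_squares Z_fin Z_odd wC.
pose y := act (g * s^-1, 1)%g (val x).
have y_rep : rep_set y by apply: rep_set_act; exact: set_mem (valP x).
have y_fix : tau_config y = y.
  have sy := congr1 (act (g * s^-1, 1)%g) (generic_central gx sC).
  rewrite actM in sy; rewrite /y tau_act -ghx actM -[RHS]sy.
  congr (act (_, _) _) => /=; first by rewrite mul1g mulgVK.
  by rewrite mul1g -mulgA (centerV sC) mulgA gh -sw mulgK.
pose y' : rep_fix G S := exist _ y (mem_set (conj y_rep y_fix)).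
exists (class y'); first by exists y' => //; exact: generic_act.
rewrite natural_mapE; apply/esym/cover_classP.
by exists (g * s^-1, 1)%g; exact: erefl.
Qed.

End Fibres.

(** * The natural map is continuous and closed *)

Section NaturalMapTopology.
Context (R : realType) (n : nat) (G : lieGroupType R n).
Context (S : nonorientable_surface).

Lemma act_continuous N : continuous (fun p : (G * G) * config G N => act p.1 p.2).
Proof.
pose P := ((G * G) * config G N)%type.
have k1 : continuous (fun p : P => p.1.1).
  exact: continuous_fcomp (@fst_continuous _ _) (@fst_continuous _ _).
have k2 : continuous (fun p : P => p.1.2).
  exact: continuous_fcomp (@snd_continuous _ _) (@fst_continuous _ _).
have x1 : continuous (fun p : P => p.2.1).
  exact: continuous_fcomp (@fst_continuous _ _) (@snd_continuous _ _).
have x2 : continuous (fun p : P => p.2.2).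
  exact: continuous_fcomp (@snd_continuous _ _) (@snd_continuous _ _).
have V1 : continuous (fun p : P => p.2.1.1).
  exact: continuous_fcomp (@fst_continuous _ _) x1.
have c1 : continuous (fun p : P => p.2.1.2).
  exact: continuous_fcomp (@snd_continuous _ _) x1.
have V2 : continuous (fun p : P => p.2.2.1).
  exact: continuous_fcomp (@fst_continuous _ _) x2.
have c2 : continuous (fun p : P => p.2.2.2).
  exact: continuous_fcomp (@snd_continuous _ _) x2.
have conj_continuous (k : P -> G) (V : P -> 'rV[G]_N) :
    continuous k -> continuous V -> continuous (fun p => conj_row (k p) (V p)).
  move=> kc Vc; apply: continuous_row => j.
  rewrite (_ : (fun x => _) = (fun p => k p * V p ord0 j * (k p)^-1)%g); last first.
    by apply/funext => p; rewrite mxE.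
  apply: continuous_mulg; last exact: continuous_invg.
  apply: continuous_mulg => //.
  exact: continuous_fcomp (@row_entry_continuous _ _ j) Vc.
rewrite (_ : (fun p => _) = (fun p : P =>
    ((conj_row p.1.1 p.2.1.1, p.1.1 * p.2.1.2 * (p.1.2)^-1),
     (conj_row p.1.2 p.2.2.1, p.1.2 * p.2.2.2 * (p.1.1)^-1)))%g); last first.
  by apply/funext => -[[g h] [[V c] [V' c']]].
apply: continuous_pair; apply: continuous_pair; do ?exact: conj_continuous.
  by apply: continuous_mulg; [exact: continuous_mulg|exact: continuous_invg].
by apply: continuous_mulg; [exact: continuous_mulg|exact: continuous_invg].
Qed.

Lemma tau_fixed_closed N : closed [set x : config G N | tau_config x = x].
Proof.
pose P := config G N.
have V1 : continuous (fun p : P => p.1.1).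
  exact: continuous_fcomp (@fst_continuous _ _) (@fst_continuous _ _).
have c1 : continuous (fun p : P => p.1.2).
  exact: continuous_fcomp (@snd_continuous _ _) (@fst_continuous _ _).
have V2 : continuous (fun p : P => p.2.1).
  exact: continuous_fcomp (@fst_continuous _ _) (@snd_continuous _ _).
have c2 : continuous (fun p : P => p.2.2).
  exact: continuous_fcomp (@snd_continuous _ _) (@snd_continuous _ _).
rewrite (_ : [set x | _] = \bigcap_(j in [set: 'I_N])
    [set x : P | x.1.1 ord0 j = x.2.1 ord0 j] `&` [set x : P | x.1.2 = x.2.2]).
  apply: closedI; last exact: closed_equalizer (@lie_hausdorff _ _ G) c1 c2.
  apply: closed_bigI => j _; apply: closed_equalizer (@lie_hausdorff _ _ G) _ _.
    exact: continuous_fcomp (@row_entry_continuous _ _ j) V1.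
  exact: continuous_fcomp (@row_entry_continuous _ _ j) V2.
apply/seteqP; split=> -[[V c] [V' c']] /= => [[-> ->]//|[VV' ->]].
by rewrite /tau_config /=; suff -> : V = V' by []; apply/rowP => j; exact: VV'.
Qed.

Lemma class_continuous : continuous (@class R n G S).
Proof. exact: pi_continuous. Qed.

Lemma cover_class_continuous : continuous (@cover_class R n G S).
Proof. exact: pi_continuous. Qed.

Lemma rep_incl_continuous : continuous (@rep_incl R n G S).
Proof.
apply: continuous_comp_initial; exact: initial_continuous.
Qed.

Lemma natural_map_continuous : continuous (natural_map G S).
Proof.
apply/quotient_continuous.
rewrite (_ : _ \o _ = @cover_class _ _ G S \o @rep_incl _ _ G S).
  exact: continuous_fcomp cover_class_continuous rep_incl_continuous.
by apply/funext => x; exact: natural_mapE.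
Qed.

Definition act_rep (k : G * G) (x : rep G S) : rep G S :=
  exist _ (act k (val x)) (mem_set (rep_set_act k (set_mem (valP x)))).

Lemma act_rep_continuous : continuous (fun p : (G * G) * rep G S => act_rep p.1 p.2).
Proof.
apply: continuous_comp_initial.
apply: (@continuous_fcomp _ _ _ (fun p : (G * G) * rep G S => (p.1, val p.2)) _
  (@act_continuous _)).
apply: continuous_pair; first exact: fst_continuous.
apply: continuous_fcomp; first exact: initial_continuous.
exact: snd_continuous.
Qed.

(** M^tau is closed in M because G is Hausdorff. *)
Lemma rep_incl_closed (C : set (rep_fix G S)) :
  closed C -> closed (@rep_incl _ _ G S @` C).
Proof.
move=> cC; have [E oE EC] :
    exists2 E : set (config G (width S)), open E & val @^-1` E = ~` C.
  exact: closed_openC cC.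
rewrite (_ : _ @` _ = val @^-1` (~` E `&` [set x | tau_config x = x])).
  apply: preimage_closed; first by move=> ? _; exact: initial_continuous.
  apply: closedI; first exact: open_closedC.
  exact: tau_fixed_closed.
apply/seteqP; split=> [_ [x Cx <-]|x [/= nEx tx]].
  split; last exact: rep_fixP.
  by move=> /= Ex; have : (~` C) x by rewrite -EC.
pose y : rep_fix G S := exist _ (val x) (mem_set (conj (set_mem (valP x)) tx)).
exists y; last exact: val_inj.
by apply: contrapT => nCy; apply: nEx; have : (~` C) y by []; rewrite -EC.
Qed.

(** The preimage in M of the image of C is the K-saturation of a closed set D.
It is closed since K is compact: if no k carries x into D, then by continuity
the same holds for each k near a given one and all points near x, and finitely
many such neighbourhoods cover K. *)
Lemma natural_map_closed (C : set (moduli G S)) :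
  compact [set: G] -> closed C -> closed (natural_map G S @` C).
Proof.
move=> cG cC; pose D := @rep_incl _ _ G S @` (@class _ _ G S @^-1` C).
have cD : closed D.
  by apply: rep_incl_closed; apply: preimage_closed cC => ? _; exact: class_continuous.
have cK : compact [set: G * G] by rewrite -setXTT; exact: compact_setX.
have saturation x :
    (natural_map G S @` C) (cover_class x) <-> exists k, D (act_rep k x).
  split=> [[p Cp]|[k [y Cy yx]]].
    rewrite -[p]class_reprK natural_mapE => /esym/cover_classP[k kx].
    exists k; exists (class_repr p); first by rewrite /= class_reprK.
    exact/esym/val_inj.
  exists (class y) => //; rewrite natural_mapE; apply/esym/cover_classP; exists k.
  by rewrite yx.
rewrite -openC.
(* Openness in the quotient topology, unfolded. *)
change (open (@cover_class _ _ G S @^-1` ~` (natural_map G S @` C))).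
rewrite openE => x nx; rewrite /interior.
have near_k (k : G * G) : [set: G * G] k ->
    \forall k' \near k & x' \near x, ~ D (act_rep k' x').
  move=> _; have nD : (~` D) (act_rep k x).
    by move=> Dk; apply: nx; apply/saturation; exists k.
  exact: (@act_rep_continuous (k, x) _ (open_nbhs_nbhs (conj (closed_openC cD) nD))).
have /(_ _)/= := (compact_near_coveringP [set: G * G]).1 cK _ (nbhs x)
  (fun x' k => ~ D (act_rep k x')) _ near_k.
by apply: filterS => x' nx' /saturation[k]; exact: nx'.
Qed.

End NaturalMapTopology.

(** * The natural map between moduli spaces *)

Theorem theorem1 (R : realType) (n : nat) (G : lieGroupType R n)
    (G_compact : compact [set: G]) (G_connected : connected [set: G])
    (G_semisimple : semisimple G) (S : nonorientable_surface) :
  [/\ (forall p : moduli G S, fixed_locus G S (natural_map G S p)),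
      (forall p : moduli G S, smooth_moduli G S p ->
         [set p' | natural_map G S p' = natural_map G S p]
           #= center_mod_squares G)
    & (smooth_fixed_locus G S !=set0 ->
         (restricts_to_homeo (smooth_moduli G S) (smooth_fixed_locus G S)
            (natural_map G S)
          <-> odd_card (group_center G)))].
Proof.
have Z_finite := center_finite G_compact G_semisimple.
split; first exact: natural_map_fixed.
  move=> p p_smooth; rewrite (card_eql (fibre_card p_smooth)).
  exact: card_center_involutions.
move=> [q0 q0_smooth]; split=> [[g [_ g_fun gK _ _]]|Z_odd].
  apply/odd_centerP => // t It.
  have [x gx xq] := g_fun _ q0_smooth.
  have I1 : center_involutions (1%g : G) by split; [exact: center1|rewrite mulg1].
  have := gK _ (smooth_twist gx It); rewrite natural_map_twist//.
  rewrite gK; last by exists x.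
  rewrite -{1}(twist1 x) => /esym/(twist_inj gx).
  by apply; exact: mem_set.
(* Off the smooth fixed locus, g takes a preimage of q0. *)
have /choice[g gP] (q : moduli_cover G S) : exists p,
    smooth_fixed_locus G S q -> smooth_moduli G S p /\ natural_map G S p = q.
  have [q_smooth|nq] := pselect (smooth_fixed_locus G S q).
    by have [p ps pq] := natural_map_onto Z_odd Z_finite q_smooth; exists p.
  have [p _ _] := natural_map_onto Z_odd Z_finite q0_smooth.
  by exists p => /nq.
have nat_inj p p' : smooth_moduli G S p ->
    natural_map G S p' = natural_map G S p -> p' = p.
  move=> [x gx <-] /(natural_map_fibre gx)[t It ->].
  have /odd_centerP-/(_ Z_finite _ It) -> := Z_odd.
  by rewrite twist1.
exists g; split.
- by move=> p /natural_map_smooth.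
- by move=> q /gP[].
- move=> p p_smooth; have [gs gE] := gP _ ((natural_map_smooth p).2 p_smooth).
  exact: nat_inj.
- by move=> q /gP[].
split; first exact/continuous_subspaceT/natural_map_continuous.
(* On the smooth fixed locus, the preimage of C under g is the image of C. *)
apply/continuous_closedP => C cC; apply/closed_subspaceP.
exists (natural_map G S @` C); first exact: natural_map_closed.
apply/seteqP; split=> [q [[p Cp pq] qs]|q [Cq qs]]; split=> //.
  have [gs gE] := gP q qs.
  by have pE : p = g q by [apply: nat_inj; rewrite ?pq]; rewrite pE in Cp.
by have [_ <-] := gP q qs; exists (g q).
Qed.
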